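(* Let $\Phi$ be a logic program. If $e:[\forall\underline{x}].\ \underline{A}\Rightarrow B$ is derivable given axioms $\Phi$ with $e$ in beta-normal form, then the transformed judgement $F(e:[\forall\underline{x}].\ \underline{A}\Rightarrow B)$ is derivable given axioms $F(\Phi)$.
   Context: Syntax: first-order terms $t ::= x \mid f(t_1,\dots,t_n)$; atomic formulas $P(t_1,\dots,t_n)$; Horn formulas $[\forall \underline{x}].\ A_1,\dots,A_n \Rightarrow A$ ($n\ge0$), $\forall\underline{x}$ quantifying all free term variables, $[\forall\underline{x}].F$ meaning $F$ or $\forall\underline{x}.F$. Proof terms $p,e ::= \kappa \mid a \mid \lambda a.e \mid e\ e'$; beta-reduction: congruence closure of $(\lambda a.p)p'\to[p'/a]p$. A logic program $\Phi$ is a list of closed Horn formulas labelled by distinct proof-term constants $\kappa$. Typing given $\Phi$: (axiom) $\kappa:\forall\underline{x}.F$ if $(\kappa:\forall\underline{x}.F)\in\Phi$; (gen) $e:F\ \Rightarrow\ e:\forall\underline{x}.F$; (inst) $e:\forall\underline{x}.F\ \Rightarrow\ e:[\underline{t}/\underline{x}]F$; (cut) from $e_1:\underline{A}\Rightarrow D$ and $e_2:\underline{B},D\Rightarrow C$ infer $\lambda\underline{a}.\lambda\underline{b}.(e_2\ \underline{b})(e_1\ \underline{a}):\underline{A},\underline{B}\Rightarrow C$ ($\underline{a},\underline{b}$ fresh proof-term variables of the lengths of $\underline{A},\underline{B}$). It is known that a typed normal proof term of $[\forall\underline{x}].A_1,\dots,A_m\Rightarrow B$ is either a constant $\kappa$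 or of the form $\lambda a_1\cdots\lambda a_m.n$ with $n$ first-order (built from proof variables and constants by application) and normal. Representation: for a map $\phi$ from proof-term variables to first-order terms, define on first-order normal proof terms $\llbracket a\rrbracket_\phi=\phi(a)$ and $\llbracket\kappa\ p_1\cdots p_n\rrbracket_\phi=f_\kappa(\llbracket p_1\rrbracket_\phi,\dots,\llbracket p_n\rrbracket_\phi)$, where $f_\kappa$ is a new function symbol associated with $\kappa$. For $A\equiv P(t_1,\dots,t_n)$ and a term $t'$ with free variables disjoint from those of the $t_i$, $A[t']$ denotes $P(t_1,\dots,t_n,t')$. Realizability transformation: $F(\kappa:\forall\underline{x}.A_1,\dots,A_m\Rightarrow B)=\kappa:\forall\underline{x}.\forall\underline{y}.A_1[y_1],\dots,A_m[y_m]\Rightarrow B[f_\kappa(y_1,\dots,y_m)]$, and $F(\lambda\underline{a}.n:[\forall\underline{x}].A_1,\dots,A_m\Rightarrow B)=\lambda\underline{a}.n:[\forall\underline{x}.\forall\underline{y}].A_1[y_1],\dots,A_m[y_m]\Rightarrow B[\llbracket n\rrbracket_{[\underline{y}/\underline{a}]}]$, where in both cases $y_1,\dots,y_m$ are fresh distinct term variables and $[\underline{y}/\underline{a}]$ maps $a_i$ to $y_i$. $F(\Phi)$ is obtained by applying $F$ to every axiom of $\Phi$. *)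

(* Defs.v *)
From Stdlib Require Import List Arith.
Import ListNotations.

Set Implicit Arguments.

(** * First-order syntax

    Function symbols [Fn], predicate symbols [Pr] and proof-term constants [K]
    are arbitrary types.  Symbols are variadic, so that [P(t1,..,tn)] and
    [P(t1,..,tn,t')] use the same [P]. *)

Inductive term (Fn : Type) : Type :=
| Var : nat -> term Fn
| Fun : Fn -> list (term Fn) -> term Fn.

Arguments Var {Fn} x.

Record atom (Fn Pr : Type) : Type := Atom {
  pred : Pr;
  args : list (term Fn)
}.

(** The quantifier-free Horn formula [body => head]. *)
Record clause (Fn Pr : Type) : Type := Clause {
  body : list (atom Fn Pr);
  head : atom Fn Pr
}.

(** [Open c] is [c] itself; [All c] is [forall x. c] where [x] lists all the
    term variables of [c], which is why no list of binders is stored.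
    [All]-formulas that differ by a renaming of their variables are distinct
    here, but each is derivable from the other by [inst] followed by [gen]. *)
Inductive horn (Fn Pr : Type) : Type :=
| Open : clause Fn Pr -> horn Fn Pr
| All : clause Fn Pr -> horn Fn Pr.

Definition matrix Fn Pr (h : horn Fn Pr) : clause Fn Pr :=
  match h with Open c => c | All c => c end.

Definition with_matrix Fn Pr Fn' Pr' (h : horn Fn Pr) (c' : clause Fn' Pr') :
    horn Fn' Pr' :=
  match h with Open _ => Open c' | All _ => All c' end.

Fixpoint tvars Fn (t : term Fn) : list nat :=
  match t with
  | Var x => [x]
  | Fun _ ts => flat_map (@tvars Fn) ts
  end.

Definition avars Fn Pr (A : atom Fn Pr) : list nat :=
  flat_map (@tvars Fn) (args A).

Definition cvars Fn Pr (c : clause Fn Pr) : list nat :=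
  flat_map (@avars Fn Pr) (body c) ++ avars (head c).

Fixpoint tsubst Fn (s : nat -> term Fn) (t : term Fn) : term Fn :=
  match t with
  | Var x => s x
  | Fun f ts => Fun f (map (tsubst s) ts)
  end.

Definition asubst Fn Pr (s : nat -> term Fn) (A : atom Fn Pr) : atom Fn Pr :=
  Atom (pred A) (map (tsubst s) (args A)).

Definition csubst Fn Pr (s : nat -> term Fn) (c : clause Fn Pr) :
    clause Fn Pr :=
  Clause (map (asubst s) (body c)) (asubst s (head c)).

(** * Proof terms, with de Bruijn indices for the proof-term variables *)

Inductive pterm (K : Type) : Type :=
| PConst : K -> pterm K
| PVar : nat -> pterm K
| PLam : pterm K -> pterm K
| PApp : pterm K -> pterm K -> pterm K.

Arguments PVar {K} i.

(** Adds [d] to every index that is free above [k] binders. *)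
Fixpoint lift K (d k : nat) (e : pterm K) : pterm K :=
  match e with
  | PConst c => PConst c
  | PVar i => if i <? k then PVar i else PVar (d + i)
  | PLam e' => PLam (lift d (S k) e')
  | PApp e1 e2 => PApp (lift d k e1) (lift d k e2)
  end.

(** Substitutes [p] for the index [k] and removes the binder of [k]. *)
Fixpoint psubst K (k : nat) (p e : pterm K) : pterm K :=
  match e with
  | PConst c => PConst c
  | PVar i => match i ?= k with
              | Lt => PVar i
              | Eq => lift k 0 p
              | Gt => PVar (Nat.pred i)
              end
  | PLam e' => PLam (psubst (S k) p e')
  | PApp e1 e2 => PApp (psubst k p e1) (psubst k p e2)
  end.

Inductive beta K : pterm K -> pterm K -> Prop :=
| beta_redex : forall e p, beta (PApp (PLam e) p) (psubst 0 p e)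
| beta_lam : forall e e', beta e e' -> beta (PLam e) (PLam e')
| beta_app_l : forall e1 e1' e2,
    beta e1 e1' -> beta (PApp e1 e2) (PApp e1' e2)
| beta_app_r : forall e1 e2 e2',
    beta e2 e2' -> beta (PApp e1 e2) (PApp e1 e2').

Definition beta_normal K (e : pterm K) : Prop :=
  ~ exists e', beta e e'.

Fixpoint plams K (n : nat) (e : pterm K) : pterm K :=
  match n with 0 => e | S n' => PLam (plams n' e) end.

Definition papps K (e : pterm K) (es : list (pterm K)) : pterm K :=
  fold_left (@PApp K) es e.

(** [[PVar (k+n-1); ..; PVar k]]: the variables of [n] consecutive binders,
    outermost first, seen from below [k] further binders. *)
Definition binders K (n k : nat) : list (pterm K) :=
  map PVar (rev (seq k n)).

(** [\a1..\an. \b1..\bk. (e2 b1..bk) (e1 a1..an)]; lifting [e1] and [e2]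
    makes the [a]'s and [b]'s fresh. *)
Definition cut_term K (n k : nat) (e1 e2 : pterm K) : pterm K :=
  plams (n + k)
    (PApp (papps (lift (n + k) 0 e2) (binders K k 0))
          (papps (lift (n + k) 0 e1) (binders K n k))).

(** * Logic programs and typing *)

(** The entry [(kappa, c)] is the axiom [kappa : All c]. *)
Definition program (Fn Pr K : Type) : Type := list (K * clause Fn Pr).

Definition logic_program Fn Pr K (Phi : program Fn Pr K) : Prop :=
  NoDup (map fst Phi).

Inductive derivable Fn Pr K (Phi : program Fn Pr K) :
    pterm K -> horn Fn Pr -> Prop :=
| axiom : forall kappa c,
    In (kappa, c) Phi ->
    derivable Phi (PConst kappa) (All c)
| gen : forall e c,
    derivable Phi e (Open c) ->
    derivable Phi e (All c)
| inst : forall e c (s : nat -> term Fn),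
    derivable Phi e (All c) ->
    derivable Phi e (Open (csubst s c))
| cut : forall e1 e2 As Bs C D,
    derivable Phi e1 (Open (Clause As D)) ->
    derivable Phi e2 (Open (Clause (Bs ++ [D]) C)) ->
    derivable Phi (cut_term (length As) (length Bs) e1 e2)
      (Open (Clause (As ++ Bs) C)).

(** * Realizability transformation

    The target signature is [Fn + K]: [inl f] is an original function symbol
    and [inr kappa] is the new symbol [f_kappa]. *)

Fixpoint embed Fn K (t : term Fn) : term (Fn + K) :=
  match t with
  | Var x => Var x
  | Fun f ts => Fun (inl f) (map (@embed Fn K) ts)
  end.

(** [A[t']] *)
Definition extend_atom Fn Pr K (A : atom Fn Pr) (t' : term (Fn + K)) :
    atom (Fn + K) Pr :=
  Atom (pred A) (map (@embed Fn K) (args A) ++ [t']).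

(** [A1[y1],..,Am[ym] => B[r]] *)
Definition realize_clause Fn Pr K (ys : list nat) (r : term (Fn + K))
    (c : clause Fn Pr) : clause (Fn + K) Pr :=
  Clause (map (fun Ay => extend_atom (fst Ay) (@Var (Fn + K) (snd Ay)))
              (combine (body c) ys))
         (extend_atom (head c) r).

(** [interp_spine phi p ts] represents [p p1 .. pn], where [ts] already
    represents [p1 .. pn].  It is [None] unless [p p1 .. pn] has one of the
    shapes [a] and [kappa q1 .. qk], hereditarily. *)
Fixpoint interp_spine Fn K (phi : nat -> option (term (Fn + K)))
    (p : pterm K) (ts : list (term (Fn + K))) : option (term (Fn + K)) :=
  match p with
  | PVar a => match ts with [] => phi a | _ :: _ => None end
  | PConst kappa => Some (Fun (inr kappa) ts)
  | PApp p1 p2 =>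
      match interp_spine phi p2 [] with
      | Some t => interp_spine phi p1 (t :: ts)
      | None => None
      end
  | PLam _ => None
  end.

Definition interp Fn K (phi : nat -> option (term (Fn + K))) (p : pterm K) :
    option (term (Fn + K)) :=
  interp_spine phi p [].

(** [[y1..ym / a1..am]]: below the binders [\a1..\am], the variable [ai] has
    index [m - i]. *)
Definition binder_map Fn K (ys : list nat) (a : nat) :
    option (term (Fn + K)) :=
  nth_error (map Var (rev ys)) a.

Fixpoint strip_lams K (m : nat) (e : pterm K) : option (pterm K) :=
  match m, e with
  | 0, _ => Some e
  | S m', PLam e' => strip_lams m' e'
  | S _, _ => None
  end.

Definition const_realizer Fn K (ys : list nat) (kappa : K) : term (Fn + K) :=
  Fun (inr kappa) (map Var ys).

Definition realizer Fn K (ys : list nat) (e : pterm K) :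
    option (term (Fn + K)) :=
  match e with
  | PConst kappa => Some (const_realizer Fn ys kappa)
  | _ =>
      match strip_lams (length ys) e with
      | Some n => interp (@binder_map Fn K ys) n
      | None => None
      end
  end.

(** A choice, for every formula, of the fresh distinct variables
    [y1, .., ym] on which the transformation depends. *)
Definition fresh_choice Fn Pr (nu : clause Fn Pr -> list nat) : Prop :=
  forall c,
    length (nu c) = length (body c) /\
    NoDup (nu c) /\
    (forall y, In y (nu c) -> ~ In y (cvars c)).

(** The formula of the transformed judgement [F(e : h)], whose proof term is
    again [e]; [None] if [e] is neither a constant nor of the form
    [\a1..\am. n] with [n] in the domain of [interp]. *)
Definition transform Fn Pr K (nu : clause Fn Pr -> list nat)
    (e : pterm K) (h : horn Fn Pr) : option (horn (Fn + K) Pr) :=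
  match realizer Fn (nu (matrix h)) e with
  | Some r =>
      Some (with_matrix h (realize_clause (nu (matrix h)) r (matrix h)))
  | None => None
  end.

Definition transform_program Fn Pr K (nu : clause Fn Pr -> list nat)
    (Phi : program Fn Pr K) : program (Fn + K) Pr K :=
  map (fun kc =>
         (fst kc,
          realize_clause (nu (snd kc))
            (const_realizer Fn (nu (snd kc)) (fst kc)) (snd kc)))
      Phi.

Lemma fresh_choice_exists Fn Pr :
  exists nu : clause Fn Pr -> list nat, fresh_choice nu.
Proof.
exists (fun c => seq (S (list_max (cvars c))) (length (body c))).
intro c; split; [apply length_seq | split; [apply seq_NoDup |]].
intros y Hy Hc; apply in_seq in Hy as [Hy _].
assert (H := proj1 (list_max_le (cvars c) _) (le_n _)).
rewrite Forall_forall in H; apply H in Hc.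
exact (Nat.lt_irrefl _ (Nat.le_trans _ _ _ Hy Hc)).
Qed.

Lemma transform_axiom Fn Pr K (nu : clause Fn Pr -> list nat)
    (Phi : program Fn Pr K) kappa c :
  In (kappa, c) Phi ->
  exists c', In (kappa, c') (transform_program nu Phi) /\
             transform nu (PConst kappa) (All c) = Some (All c').
Proof.
intro H; eexists; split; [exact (in_map _ _ _ H) | reflexivity].
Qed.

(* Main.v *)
(** A cut makes [e2] the head of a nonempty application, and a derivable term
    that is not a constant begins with as many abstractions as its formula has
    premises.  Hence, in a normal term, the major premise [e2] of a cut is a
    constant kappa, and the minor premise [e1] is a constant or proves a formula
    without premises.  In both cases the realizer of the cut is
    [f_kappa(ys, r1)], where [r1] realizes [e1] and [ys] are the realizer
    variables of the side premises of kappa.  Instantiating the variable of its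
    last premise by [r1] makes the transformed premises fit for a cut. *)

Require Import Defs.
From Stdlib Require Import List Arith Lia.
Import ListNotations.

Set Implicit Arguments.

(** * Normal proof terms and the shape of derivable ones *)

Lemma not_normal_lam_redex K (q p : pterm K) :
  ~ beta_normal (PApp (PLam q) p).
Proof. intro H; apply H; eexists; apply beta_redex. Qed.

Lemma beta_normal_plams K n (e : pterm K) :
  beta_normal (plams n e) -> beta_normal e.
Proof.
  induction n as [|n IH]; simpl; auto.
  intro H; apply IH; intros [e' He]; apply H; eexists; apply beta_lam, He.
Qed.

Lemma beta_normal_app_r K (p q : pterm K) :
  beta_normal (PApp p q) -> beta_normal q.
Proof. intros H [q' Hq]; apply H; eexists; apply beta_app_r, Hq. Qed.

Lemma beta_normal_papps K qs (p : pterm K) :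
  beta_normal (papps p qs) -> beta_normal p.
Proof.
  revert p; induction qs as [|q qs IH]; simpl; intros p H; auto.
  apply IH in H; intros [p' Hp]; apply H; eexists; apply beta_app_l, Hp.
Qed.

(** The reduct is left unspecified: normality only asks whether some step exists, and this avoids
    commuting [lift] with [psubst]. *)
Lemma beta_lift K (e e' : pterm K) :
  beta e e' -> forall d k, exists e'', beta (lift d k e) e''.
Proof.
  induction 1 as [e p|e e' _ IH|e1 e1' e2 _ IH|e1 e2 e2' _ IH]; intros d k; simpl.
  - eexists; apply beta_redex.
  - destruct (IH d (S k)); eexists; apply beta_lam; eauto.
  - destruct (IH d k); eexists; apply beta_app_l; eauto.
  - destruct (IH d k); eexists; apply beta_app_r; eauto.
Qed.

Lemma beta_normal_lift K d k (e : pterm K) :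
  beta_normal (lift d k e) -> beta_normal e.
Proof. intros H [e' He]; apply H; exact (beta_lift He d k). Qed.

Lemma not_normal_papps_lam K (q : pterm K) qs :
  qs <> [] -> ~ beta_normal (papps (PLam q) qs).
Proof.
  destruct qs as [|p qs]; [congruence|]; intros _ H.
  apply (beta_normal_papps qs) in H; exact (not_normal_lam_redex H).
Qed.

Lemma papps_snoc K (p : pterm K) qs q :
  papps p (qs ++ [q]) = PApp (papps p qs) q.
Proof. unfold papps; now rewrite fold_left_app. Qed.

Lemma length_binders K n k : length (binders K n k) = n.
Proof. unfold binders; now rewrite length_map, length_rev, length_seq. Qed.

(** [gen] and [inst] change neither the proof term nor the number of premises, and [cut] puts one
    abstraction per premise of its conclusion over an application. *)
Lemma derivable_shape Fn Pr K (Phi : program Fn Pr K) e h :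
  derivable Phi e h ->
  (exists kappa, e = PConst kappa) \/
  (exists p q, e = plams (length (body (matrix h))) (PApp p q)).
Proof.
  induction 1 as [kappa c _|e c _ IH|e c s _ IH|e1 e2 As Bs C D _ _ _ _]; simpl in *.
  - left; eauto.
  - exact IH.
  - now rewrite length_map.
  - right; rewrite length_app; unfold cut_term; eauto.
Qed.

(** * Substitution in realized clauses *)

Section TermSubstitution.
Variables (Fn K : Type).

Lemma tsubst_Var (t : term Fn) : tsubst Var t = t.
Proof.
  revert t; fix IH 1; intros [x|f ts]; simpl; [reflexivity|f_equal].
  induction ts as [|t ts IHts]; simpl; f_equal; auto.
Qed.

Lemma map_tsubst_Var (s : nat -> term Fn) ys : map (tsubst s) (map Var ys) = map s ys.
Proof. now rewrite map_map. Qed.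

Lemma tsubst_embed (s : nat -> term Fn) (s' : nat -> term (Fn + K)) t :
  (forall x, In x (tvars t) -> s' x = embed K (s x)) ->
  tsubst s' (embed K t) = embed K (tsubst s t).
Proof.
  revert t; fix IH 1; intros [x|f ts]; simpl; intro H; [auto|f_equal].
  induction ts as [|t ts IHts]; simpl in *; f_equal.
  - apply IH; intros x Hx; apply H, in_or_app; auto.
  - apply IHts; intros x Hx; apply H, in_or_app; auto.
Qed.

End TermSubstitution.

Lemma csubst_Var Fn Pr (c : clause Fn Pr) : csubst Var c = c.
Proof.
  assert (HA : forall A : atom Fn Pr, asubst Var A = A).
  { intros [P ts]; unfold asubst; simpl; f_equal.
    erewrite map_ext by apply tsubst_Var; apply map_id. }
  destruct c as [As B]; unfold csubst; simpl; f_equal; auto.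
  erewrite map_ext by apply HA; apply map_id.
Qed.

Lemma asubst_extend_atom Fn Pr K (s : nat -> term Fn)
    (s' : nat -> term (Fn + K)) (A : atom Fn Pr) t :
  (forall x, In x (avars A) -> s' x = embed K (s x)) ->
  asubst s' (extend_atom A t) = extend_atom (asubst s A) (tsubst s' t).
Proof.
  intro H; unfold asubst, extend_atom; simpl; f_equal.
  rewrite map_app, !map_map; simpl; f_equal.
  apply map_ext_in; intros u Hu; apply tsubst_embed.
  intros x Hx; apply H, in_flat_map; eauto.
Qed.

(** Generalizes [realize_clause] from variables to arbitrary terms as extra arguments of the
    premises, a form that is stable under instantiation. *)
Definition extend_clause Fn Pr K (ts : list (term (Fn + K))) (r : term (Fn + K))
    (c : clause Fn Pr) : clause (Fn + K) Pr :=
  Clause (map (fun At => extend_atom (fst At) (snd At)) (combine (body c) ts))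
         (extend_atom (Defs.head c) r).

Lemma realize_clause_extend Fn Pr K ys (r : term (Fn + K)) (c : clause Fn Pr) :
  realize_clause ys r c = extend_clause (map Var ys) r c.
Proof.
  unfold realize_clause, extend_clause; f_equal.
  generalize (body c); induction ys as [|y ys IH]; intros [|A As]; simpl; f_equal; auto.
Qed.

Lemma csubst_extend_clause Fn Pr K (s : nat -> term Fn)
    (s' : nat -> term (Fn + K)) (c : clause Fn Pr) ts r :
  (forall x, In x (cvars c) -> s' x = embed K (s x)) ->
  csubst s' (extend_clause ts r c) =
  extend_clause (map (tsubst s') ts) (tsubst s' r) (csubst s c).
Proof.
  destruct c as [As B]; unfold csubst, extend_clause, cvars; simpl; intro H; f_equal.
  - revert ts H; induction As as [|A As IH]; intros [|t ts] H; simpl in *; auto.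
    f_equal; [apply asubst_extend_atom | apply IH];
      intros x Hx; apply H; rewrite !in_app_iff in *; tauto.
  - apply asubst_extend_atom; intros x Hx; apply H, in_or_app; auto.
Qed.

(** Since [ys] has no repetition, overriding [s] one variable at a time never undoes an earlier
    assignment. *)
Lemma substitution_extension (T : Type) (ys : list nat) (ts : list T) (s : nat -> T) :
  NoDup ys -> length ts = length ys ->
  exists s', map s' ys = ts /\ forall x, ~ In x ys -> s' x = s x.
Proof.
  intro H; revert ts; induction H as [|y ys Hy _ IH]; intros [|t ts] Hl;
    simpl in *; try discriminate.
  - exists s; auto.
  - destruct (IH ts) as [s' [H1 H2]]; [lia|].
    exists (fun x => if Nat.eq_dec x y then t else s' x); split.
    + destruct (Nat.eq_dec y y) as [_|]; [f_equal|congruence].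
      rewrite <- H1; apply map_ext_in; intros x Hx.
      destruct (Nat.eq_dec x y); congruence.
    + intros x Hx; destruct (Nat.eq_dec x y) as [->|]; [tauto|].
      apply H2; tauto.
Qed.

(** The realizer variables do not occur in [c], so one substitution can act as [s] on [c] and send
    them to any prescribed terms [ts]. *)
Lemma realized_instance Fn Pr K (Psi : program (Fn + K) Pr K)
    (nu : clause Fn Pr -> list nat) e c r (s : nat -> term Fn) ts :
  fresh_choice nu ->
  derivable Psi e (All (realize_clause (nu c) r c)) ->
  length ts = length (body c) ->
  exists s', map s' (nu c) = ts /\
    derivable Psi e (Open (extend_clause ts (tsubst s' r) (csubst s c))).
Proof.
  intros Hnu He Hl; destruct (Hnu c) as [Hlen [Hnd Hfr]].
  destruct (substitution_extension (ys := nu c) ts (fun x => embed K (s x)))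
    as [s' [H1 H2]]; [exact Hnd|congruence|].
  exists s'; split; [exact H1|].
  apply inst with (s := s') in He.
  rewrite realize_clause_extend, csubst_extend_clause with (s := s) in He.
  - now rewrite map_tsubst_Var, H1 in He.
  - intros x Hx; apply H2; intro Hy; exact (Hfr x Hy Hx).
Qed.

(** * Realizers under substitution, lifting and cut *)

Section Interpretation.
Variables (Fn K : Type).
Implicit Types (phi psi : nat -> option (term (Fn + K))) (ts us : list (term (Fn + K))).

Lemma interp_spine_subst phi psi (s : nat -> term (Fn + K)) p ts :
  (forall a, psi a = option_map (tsubst s) (phi a)) ->
  interp_spine psi p (map (tsubst s) ts) =
  option_map (tsubst s) (interp_spine phi p ts).
Proof.
  intro H; revert ts; induction p as [kappa|a|p _|p IHp q IHq]; intro ts; simpl; auto.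
  - destruct ts; simpl; auto.
  - specialize (IHq []); simpl in IHq; rewrite IHq.
    destruct (interp_spine phi q []) as [t|]; simpl; auto.
    exact (IHp (t :: ts)).
Qed.

(** Relates realizers of one proof term for different choices of variables: changing the choice is a
    renaming of the realizer. *)
Lemma realizer_subst ys ys' (s : nat -> term (Fn + K)) e :
  map s ys = map Var ys' ->
  realizer Fn ys' e = option_map (tsubst s) (realizer Fn ys e).
Proof.
  intro H.
  assert (Hl : length ys' = length ys).
  { apply (f_equal (@length _)) in H; now rewrite !length_map in H. }
  assert (Hb : forall a, binder_map Fn K ys' a =
                         option_map (tsubst s) (binder_map Fn K ys a)).
  { intro a; unfold binder_map; rewrite <- nth_error_map, map_tsubst_Var.
    now rewrite !map_rev, H. }
  unfold realizer; rewrite Hl.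
  destruct e; simpl; try (unfold const_realizer; simpl; now rewrite map_tsubst_Var, H);
    destruct (strip_lams _ _) as [m|]; simpl; auto;
    exact (interp_spine_subst _ _ s m [] Hb).
Qed.

(** If no variable has a value under [phi], a term with an interpretation contains neither variables
    nor abstractions, so lifting leaves it unchanged and the map is irrelevant. *)
Lemma interp_spine_lift phi psi d p :
  (forall a, phi a = None) ->
  forall k ts r, interp_spine phi p ts = Some r ->
    interp_spine psi (lift d k p) ts = Some r.
Proof.
  intro H; induction p as [kappa|a|p _|p IHp q IHq]; simpl; intros k ts r Hr; auto.
  - destruct ts; [rewrite H in Hr|]; discriminate Hr.
  - destruct (interp_spine phi q []) as [t|] eqn:E; [|discriminate].
    now rewrite (IHq k [] t E), (IHp k (t :: ts) r Hr).
Qed.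

Lemma interp_spine_papps phi qs us :
  Forall2 (fun q u => interp phi q = Some u) qs us ->
  forall p ts, interp_spine phi (papps p qs) ts = interp_spine phi p (us ++ ts).
Proof.
  induction 1 as [|q u qs us Hq _ IH]; intros p ts; simpl; auto.
  change (papps p (q :: qs)) with (papps (PApp p q) qs).
  rewrite IH; simpl; unfold interp in Hq; now rewrite Hq.
Qed.

(** Here [xs] belongs to the binders outside the block and [zs] to those inside it. De Bruijn
    indices count from the inside, so the block starts at index [length zs], whatever [xs] is. *)
Lemma interp_binders xs ys zs :
  Forall2 (fun q u => interp (binder_map Fn K (xs ++ ys ++ zs)) q = Some u)
    (binders K (length ys) (length zs)) (map Var ys).
Proof.
  revert xs; induction ys as [|y ys IH]; intro xs; [constructor|].
  unfold binders; cbn [length]; rewrite seq_S, rev_app_distr; simpl.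
  constructor.
  - unfold interp, binder_map; simpl.
    rewrite rev_app_distr; simpl; rewrite rev_app_distr, <- !app_assoc, app_assoc.
    rewrite nth_error_map, nth_error_app2; rewrite length_app, !length_rev; [|lia].
    now rewrite Nat.sub_diag.
  (* For the rest of the block, [y] counts as an outer binder. *)
  - specialize (IH (xs ++ [y])); rewrite <- app_assoc in IH; exact IH.
Qed.

End Interpretation.

Lemma strip_plams K n (e : pterm K) : strip_lams n (plams n e) = Some e.
Proof. induction n; simpl; auto. Qed.

Lemma realizer_cut Fn K zs1 zs2 (e1 : pterm K) kappa (r1 : term (Fn + K)) :
  ((exists kappa1, e1 = PConst kappa1) \/ (zs1 = [] /\ exists p q, e1 = PApp p q)) ->
  realizer Fn zs1 e1 = Some r1 ->
  realizer Fn (zs1 ++ zs2) (cut_term (length zs1) (length zs2) e1 (PConst kappa)) =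
  Some (Fun (inr kappa) (map Var zs2 ++ [r1])).
Proof.
  intros He Hr.
  pose (phi := binder_map Fn K (zs1 ++ zs2)).
  pose (d := length zs1 + length zs2).
  assert (H1 : interp_spine phi (papps (lift d 0 e1)
                 (binders K (length zs1) (length zs2))) [] = Some r1).
  { rewrite (interp_spine_papps phi (interp_binders Fn K [] zs1 zs2)), app_nil_r.
    (* A constant collects [zs1] as its arguments, which is its realizer. Otherwise there are no
       arguments and [binder_map] of the empty list is undefined everywhere, so the lifting lemma
       applies. *)
    destruct He as [[kappa1 ->]|[-> [p [q ->]]]]; simpl map; [exact Hr|].
    apply (@interp_spine_lift Fn K (binder_map Fn K [])); [|exact Hr].
    intros [|a]; reflexivity. }
  assert (H2 := interp_binders Fn K zs1 zs2 []).
  rewrite app_nil_r in H2.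
  (* [realizer] inspects the head constructor of its argument, and [plams] hides it while the number
     of binders is unknown; hence an abstract [e] that is only known not to be a constant. *)
  assert (Hcut : forall e, (forall k, e <> PConst k) ->
            strip_lams d e = Some (PApp
              (papps (PConst kappa) (binders K (length zs2) 0))
              (papps (lift d 0 e1) (binders K (length zs1) (length zs2)))) ->
            realizer Fn (zs1 ++ zs2) e =
            Some (Fun (inr kappa) (map Var zs2 ++ [r1]))).
  { intros e Hc Hs; unfold realizer; rewrite length_app; fold d; rewrite Hs.
    unfold interp; cbn [interp_spine]; fold phi; rewrite H1.
    rewrite (interp_spine_papps phi H2).
    destruct e as [k| | |]; auto; now destruct (Hc k). }
  apply Hcut; [|apply strip_plams].
  intro k; unfold cut_term; destruct (length zs1 + length zs2); discriminate.
Qed.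

(** * Splitting the premises of a cut, and the induction on derivations *)

Lemma extend_clause_app Fn Pr K (As Bs : list (atom Fn Pr)) C
    (ts us : list (term (Fn + K))) r :
  length As = length ts ->
  extend_clause (ts ++ us) r (Clause (As ++ Bs) C) =
  Clause (body (extend_clause ts r (Clause As C)) ++
          body (extend_clause us r (Clause Bs C)))
         (extend_atom C r).
Proof.
  unfold extend_clause; simpl; intro H; f_equal; rewrite <- map_app; f_equal.
  revert ts H; induction As as [|A As IH]; intros [|t ts] H; simpl in *;
    try discriminate; f_equal; auto.
Qed.

Theorem theorem4 (Fn Pr K : Type) (Phi : program Fn Pr K)
    (nu : clause Fn Pr -> list nat) (e : pterm K) (h : horn Fn Pr) :
  logic_program Phi ->
  fresh_choice nu ->
  derivable Phi e h ->
  beta_normal e ->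
  exists h' : horn (Fn + K) Pr,
    transform nu e h = Some h' /\
    derivable (transform_program nu Phi) e h'.
Proof.
  intros _ Hnu Hd; unfold transform.
  induction Hd as [kappa c Hin|e c Hd IH|e c s Hd IH|e1 e2 As Bs C D Hd1 IH1 Hd2 IH2];
    intro Hn; simpl in *.
  - eexists; split; [reflexivity|].
    apply axiom; exact (in_map _ _ _ Hin).
  - destruct (IH Hn) as [h' [Hr Hh]].
    destruct (realizer Fn (nu c) e) as [r|]; [|discriminate].
    injection Hr as <-; eexists; split; [reflexivity|]; apply gen, Hh.
  - destruct (IH Hn) as [h' [Hr Hh]].
    destruct (realizer Fn (nu c) e) as [r|] eqn:E; [|discriminate].
    injection Hr as <-.
    destruct (Hnu (csubst s c)) as [Hl _].
    (* The variables chosen for [c] and for its instance may differ; a single [inst] applies [s] and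
       renames the former to the latter. *)
    destruct (realized_instance s (map Var (nu (csubst s c))) Hnu Hh) as [s' [Hs Hi]].
    { rewrite length_map, Hl; simpl; apply length_map. }
    rewrite (realizer_subst _ _ s' e Hs), E; simpl.
    eexists; split; [reflexivity|]; now rewrite realize_clause_extend.
  - apply beta_normal_plams in Hn.
    assert (Hk : exists kappa, e2 = PConst kappa).
    { destruct (derivable_shape Hd2) as [|[p [q ->]]]; auto; exfalso.
      cbn [matrix body] in Hn.
      (* The premise [D] supplies the leading abstraction of [e2]. Folding the outer application
         into [papps] then makes the argument list nonempty even when [Bs] is empty. *)
      rewrite length_app, (Nat.add_comm _ (length [D])) in Hn; simpl in Hn.
      rewrite <- papps_snoc in Hn.
      apply not_normal_papps_lam in Hn; auto; now destruct (binders K (length Bs) 0). }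
    destruct Hk as [kappa ->].
    apply beta_normal_app_r in Hn.
    assert (Hs : (exists kappa1, e1 = PConst kappa1) \/
                 (As = [] /\ exists p q, e1 = PApp p q)).
    { destruct (derivable_shape Hd1) as [|[p [q ->]]]; auto.
      right; destruct As as [|A As]; simpl in *; eauto; exfalso.
      apply not_normal_papps_lam in Hn; auto.
      intro H; apply (f_equal (@length _)) in H.
      rewrite length_binders in H; discriminate. }
    apply beta_normal_papps, beta_normal_lift in Hn.
    destruct (IH1 Hn) as [h1 [Hr1 Hh1]]; clear IH1.
    destruct IH2 as [h2 [Hr2 Hh2]]; [intros [e' He]; inversion He|].
    injection Hr2 as <-.
    destruct (realizer Fn (nu (Clause As D)) e1) as [r1|] eqn:E1; [|discriminate].
    injection Hr1 as <-.
    destruct (Hnu (Clause (As ++ Bs) C)) as [Hl _].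
    simpl in Hl; rewrite length_app in Hl.
    set (zs := nu (Clause (As ++ Bs) C)) in *.
    (* The variables chosen for the conclusion are split between [As] and [Bs]; those chosen for the
       two premises of the cut are unrelated to them and must be replaced. *)
    assert (Hz : exists zs1 zs2,
              zs = zs1 ++ zs2 /\ length zs1 = length As /\ length zs2 = length Bs).
    { exists (firstn (length As) zs), (skipn (length As) zs).
      rewrite firstn_skipn, length_firstn, length_skipn; split; [reflexivity|lia]. }
    destruct Hz as [zs1 [zs2 [Hz [Hz1 Hz2]]]]; rewrite Hz.
    (* [gen] followed by [inst] replaces the realizer variables while [Var] fixes the original
       clause; [tsubst s1 r1] is thus the realizer of [e1] for [zs1]. *)
    destruct (realized_instance Var (map Var zs1) Hnu (gen Hh1)) as [s1 [Hs1 Hi1]].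
    { now rewrite length_map. }
    destruct (realized_instance Var (map Var zs2 ++ [tsubst s1 r1]) Hnu (gen Hh2))
      as [s2 [Hs2 Hi2]].
    { simpl; rewrite !length_app, length_map; simpl; lia. }
    rewrite csubst_Var in Hi1, Hi2.
    unfold const_realizer in Hi2; cbn [tsubst] in Hi2.
    rewrite map_tsubst_Var, Hs2 in Hi2.
    rewrite extend_clause_app in Hi2 by now rewrite length_map.
    pose proof (cut _ Hi1 Hi2) as Hc; simpl in Hc; clear Hi2.
    rewrite <- Hz1, <- Hz2, (@realizer_cut Fn K zs1 zs2 e1 kappa (tsubst s1 r1)).
    + eexists; split; [reflexivity|].
      rewrite realize_clause_extend, map_app.
      rewrite extend_clause_app by now rewrite length_map.
      (* The proof term built by [cut] counts the realized premises; these lengths reduce to those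
         of [As] and [Bs]. *)
      rewrite !length_map, !length_combine, !length_map, Hz1, Hz2, !Nat.min_id in Hc.
      now rewrite Hz1, Hz2.
    + destruct Hs as [|[-> H]]; auto; right; split; auto.
      now apply length_zero_iff_nil.
    + now rewrite (realizer_subst _ _ s1 e1 Hs1), E1.
Qed.
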